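(* Let $\kappa$ be a perfect field, let $r, m, n \geq 2$ be integers, and let $X_\ell = (x^\ell_{ij})$, $1 \leq \ell \leq r$, be $r$ matrices of size $m \times n$ whose entries are $rmn$ distinct indeterminates. Let $R = \kappa[x^\ell_{ij} \mid 1 \leq i \leq m,\ 1 \leq j \leq n,\ 1 \leq \ell \leq r]$, let $H$ be the $m \times rn$ horizontal concatenation and $V$ the $rm \times n$ vertical concatenation of $X_1,\dots,X_r$, and let $I = I_2(H) + I_2(V) \subseteq R$. Then $I$ is a prime ideal of $R$. In particular, $S = R/I$ is an integral domain, and the variety $\mathcal{X}$ cut out by $I$ is irreducible.
   Context: For a matrix $M$ with entries in a commutative ring and a positive integer $a$, $I_a(M)$ denotes the ideal generated by the $a$-minors (determinants of $a \times a$ submatrices) of $M$. The horizontal concatenation is $H = \begin{bmatrix} X_1 & \cdots & X_r \end{bmatrix}$ and the vertical concatenation is $V = \begin{bmatrix} X_1 \\ \vdots \\ X_r \end{bmatrix}$. $R$ has the standard grading. The ideal $I = I_2(H)+I_2(V)$ is homogeneous and $\mathcal{X}$ is the variety it cuts out (a toric double determinantal variety), with homogeneous coordinate ring $S = R/I$; since $I$ is homogeneous, $\mathcal{X}$ may be regarded as either an affine or a projective variety. *)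

(* Defs.v *)
From HB Require Import structures.
From mathcomp Require Import all_boot all_order all_algebra all_field.
From mathcomp Require Import boolp classical_sets.
From mathcomp Require Import mpoly.

Set Implicit Arguments.
Unset Strict Implicit.
Unset Printing Implicit Defensive.

Import GRing.Theory.

Local Open Scope ring_scope.
Local Open Scope classical_set_scope.

Definition perfect_field (K : fieldType) : Prop :=
  forall p : {poly K}, irreducible_poly p -> separable_poly p.

Section Ideals.
Variable R : comNzRingType.

Definition gen_ideal (E : set R) : {pred R} := fun p =>
  `[< exists (k : nat) (c g : 'I_k -> R),
        (forall i, E (g i)) /\ p = \sum_(i < k) c i * g i >].

Definition add_ideal (I J : {pred R}) : {pred R} := fun p =>
  `[< exists2 a, a \in I & exists2 b, b \in J & p = a + b >].

(* In the library [idealr_closed] includes [1 \notin P], whereas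
   [prime_idealr_closed] only says that [u * v \in P] implies [u \in P] or
   [v \in P]. *)
Definition prime_ideal (P : {pred R}) : Prop :=
  idealr_closed P /\ prime_idealr_closed P.

Definition minors (a p q : nat) (M : 'M[R]_(p, q)) : set R :=
  [set d | exists (f : 'I_a -> 'I_p) (g : 'I_a -> 'I_q),
     [/\ {homo f : i j / (i < j)%N}, {homo g : i j / (i < j)%N}
       & d = \det (mxsub f g M)]].

Definition minors_ideal (a p q : nat) (M : 'M[R]_(p, q)) : {pred R} :=
  gen_ideal (minors a M).

Lemma gen_ideal0 (E : set R) : 0 \in gen_ideal E.
Proof.
apply/asboolP; exists 0%N, (fun=> 0), (fun=> 0); split=> [[]//|].
by rewrite big_ord0.
Qed.

Lemma gen_idealMD (E : set R) a :
  {in gen_ideal E &, forall u v, a * u + v \in gen_ideal E}.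
Proof.
move=> u v /asboolP [k [c [g [Eg ->]]]] /asboolP [k' [c' [g' [Eg' ->]]]].
apply/asboolP; exists (k + k')%N.
exists (fun i => match split i with inl i => a * c i | inr i => c' i end).
exists (fun i => match split i with inl i => g i | inr i => g' i end).
split=> [i|]; first by case: split.
rewrite big_split_ord /= mulr_sumr; congr (_ + _); apply: eq_bigr => i _.
  by rewrite (unsplitK (inl i)) mulrA.
by rewrite (unsplitK (inr i)).
Qed.

End Ideals.

Definition irreducible_subset (T : Type) (closed_sets : set (set T))
    (A : set T) : Prop :=
  A !=set0 /\
  forall Z1 Z2, closed_sets Z1 -> closed_sets Z2 ->
    A `<=` Z1 `|` Z2 -> A `<=` Z1 \/ A `<=` Z2.

(* [prime_idealr R] and [pred R] live in universes too large for the carrier of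
   a [set]. *)
Record spec (R : comNzRingType) : Type := Spec {
  spec_ideal :> R -> bool;
  spec_prime : prime_ideal spec_ideal
}.

Definition spec_locus (R : comNzRingType) (E : set R) : set (spec R) :=
  [set P : spec R | forall f, E f -> f \in spec_ideal P].

Definition spec_closed (R : comNzRingType) : set (set (spec R)) :=
  range (@spec_locus R).

Section Proj.
Variables (K : fieldType) (N : nat).

Definition homogeneous_ideal (P : {pred {mpoly K[N]}}) : Prop :=
  forall (f : {mpoly K[N]}) (d : nat), f \in P -> pihomog mdeg d f \in P.

(* Points of Proj K[x_1, ..., x_N] for the standard grading. *)
Record proj : Type := Proj {
  proj_point :> spec {mpoly K[N]};
  proj_homogeneous : homogeneous_ideal (spec_ideal proj_point);
  proj_relevant : ~ forall i : 'I_N, 'X_i \in spec_ideal proj_point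
}.

Definition proj_locus (E : set {mpoly K[N]}) : set proj :=
  [set P : proj | spec_locus E (proj_point P)].

Definition proj_closed : set (set proj) :=
  [set proj_locus E | E in
     [set E : set {mpoly K[N]} |
        forall f, E f -> exists d : nat, f \is d.-homog]].

End Proj.

Notation tensor_ring K r m n := {mpoly K[#|{: 'I_r * 'I_m * 'I_n}|]}.

Section DoubleDeterminantal.
Variables (K : fieldType) (r m n : nat).

Definition generic_mx (l : 'I_r) : 'M[tensor_ring K r m n]_(m, n) :=
  \matrix_(i < m, j < n) 'X_(enum_rank (l, i, j)).

Definition hcat_mx : 'M[tensor_ring K r m n]_(m, \sum_(l < r) n) :=
  \mxrow_(l < r) generic_mx l.

Definition vcat_mx : 'M[tensor_ring K r m n]_(\sum_(l < r) m, n) :=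
  \mxcol_(l < r) generic_mx l.

Definition ddet_ideal : {pred tensor_ring K r m n} :=
  add_ideal (minors_ideal 2 hcat_mx) (minors_ideal 2 vcat_mx).

Lemma meval0_minors_ideal p q (M : 'M[tensor_ring K r m n]_(p, q)) :
  (forall i j, (M i j).@[fun=> 0] = 0) ->
  {in minors_ideal 2 M, forall u, u.@[fun=> 0] = 0}.
Proof.
move=> M0 u /asboolP [k [c [g [Eg ->]]]].
rewrite (raddf_sum (meval _)) big1 // => i _; rewrite /= mevalM.
have [f [h [_ _ ->]]] := Eg i.
rewrite -det_map_mx (_ : map_mx _ _ = 0) ?det0 ?mulr0 //.
by apply/matrixP => x y; rewrite !mxE; exact: M0.
Qed.

Lemma ddet_ideal_closed : idealr_closed ddet_ideal.
Proof.
split.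
- by apply/asboolP; exists 0; rewrite ?gen_ideal0 //; exists 0;
    rewrite ?gen_ideal0 ?addr0.
- apply/negP => /asboolP [u uH [v vV /(congr1 (meval (fun=> 0)))]].
  rewrite meval1 mevalD (meval0_minors_ideal _ uH) ?(meval0_minors_ideal _ vV);
    [|by move=> i j; rewrite !mxE mevalXU..].
  by rewrite addr0 => /eqP; rewrite oner_eq0.
- move=> a u v /asboolP [u1 u1H [u2 u2V ->]] /asboolP [v1 v1H [v2 v2V ->]].
  apply/asboolP; exists (a * u1 + v1); first exact: gen_idealMD.
  by exists (a * u2 + v2); [exact: gen_idealMD | rewrite mulrDr addrACA].
Qed.

HB.instance Definition _ :=
  isIdealr.Build (tensor_ring K r m n) ddet_ideal ddet_ideal_closed.

(* Nontrivial by typing: [1 != 0] is part of [comNzRingType]. *)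
Definition coord_ring : comNzRingType := {ideal_quot ddet_ideal}.

(* K need not be algebraically closed, so the points of the varieties are
   prime ideals rather than K-rational points: over a finite field the latter
   would form a finite set, reducible as soon as it has two points. *)
Definition affine_ddet : set (spec (tensor_ring K r m n)) :=
  spec_locus [set` ddet_ideal].

Definition projective_ddet : set (proj K #|{: 'I_r * 'I_m * 'I_n}|) :=
  proj_locus [set` ddet_ideal].

End DoubleDeterminantal.

Arguments ddet_ideal : clear implicits.
Arguments affine_ddet : clear implicits.
Arguments projective_ddet : clear implicits.

(* Main.v *)
From HB Require Import structures.
Require Import Defs.
From mathcomp Require Import all_boot all_order all_algebra.
From mathcomp Require Import boolp classical_sets mpoly.

Set Implicit Arguments.
Unset Strict Implicit.
Unset Printing Implicit Defensive.

Import GRing.Theory.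

(** The ideal is the kernel of a ring morphism to a domain, hence prime.  The
    morphism is the one dual to the Segre embedding of a product of three
    projective spaces: it sends the variable [x^l_ij] to [c_l a_i b_j].  Each
    row of H is then a multiple [a_i] of the common vector [(c_l b_j)], and
    each row of V a multiple [c_l a_i] of the common vector [(b_j)], so both
    matrices become of rank at most one and their 2-minors vanish
    ([segre_map_ddet]).

    For the converse inclusion, the kernel of a morphism that maps variables to
    monomials is spanned, as a vector space, by differences of monomials with
    the same image ([toric_kernel]), so it is enough to see that two such
    monomials agree modulo the ideal.  Write a monomial as a list of triples
    [(l, i, j)].  Its image remembers the multisets of the [l], of the [i] and
    of the [j] that occur.  A 2-minor of H says that two variables of the
    monomial may exchange their indices [i], and a 2-minor of V that they may
    exchange their indices [j]; such exchanges lead from any list of triples to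
    any other one with the same three multisets ([exchange_prod]).

    The remaining claims follow formally.  The quotient by a prime ideal is a
    domain.  The locus of a prime ideal P in Spec has P as a generic point, and
    so does its locus in Proj when P is homogeneous and misses some variable.
    Homogeneity holds because the Segre morphism multiplies degrees by three. *)

Local Open Scope ring_scope.
Local Open Scope quotient_scope.

(** * Exchanging indices in products *)

Lemma mem_map_perm (T T' : eqType) (f : T -> T') (z : T') (s : seq T) :
  z \in [seq f t | t <- s] -> exists t u, z = f t /\ perm_eq s (t :: u).
Proof. by case/mapP => t ts ->; exists t, (rem t s); rewrite perm_to_rem. Qed.

Lemma perm_cons_exchange (T : eqType) (z z' : T) (s u v : seq T) :
  perm_eq (z :: s) (z' :: u) -> perm_eq u (z :: v) -> perm_eq s (z' :: v).
Proof.
move=> zs uv; rewrite -(perm_cons z) (permPl zs).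
by rewrite -(permPr (permEl (perm_catCA [:: z'] [:: z] v))) perm_cons.
Qed.

Section Exchange.
Variables (A B C : eqType) (Q : comNzRingType) (y : A * B * C -> Q).
Hypothesis swap2 : forall a b c a' b' c',
  y (a, b, c) * y (a', b', c') = y (a, b', c) * y (a', b, c').
Hypothesis swap3 : forall a b c a' b' c',
  y (a, b, c) * y (a', b', c') = y (a, b, c') * y (a', b', c).

(** Repeated exchanges of second or third components connect any two lists of
    triples with the same three projections.  The first triple [(a, b, c)] of
    [s] can be produced in [s']: pick a triple of [s'] with first component
    [a], import [b] and then [c] into it by one exchange each, and conclude by
    induction on what remains.  First components need no exchange, since the
    factors of a product can be reordered. *)
Lemma exchange_prod (s s' : seq (A * B * C)) :
  perm_eq [seq t.1.1 | t <- s] [seq t.1.1 | t <- s'] ->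
  perm_eq [seq t.1.2 | t <- s] [seq t.1.2 | t <- s'] ->
  perm_eq [seq t.2 | t <- s] [seq t.2 | t <- s'] ->
  \prod_(t <- s) y t = \prod_(t <- s') y t.
Proof.
elim: s s' => [|[[a b] c] s IHs] s' /= p1 p2 p3.
  have /esym/size0nil -> : 0%N = size s'.
    by move/perm_size: p1; rewrite size_map.
  by rewrite big_nil.
(* Bring a triple with first component a to the front of s'. *)
have : a \in [seq t.1.1 | t <- s'] by rewrite -(perm_mem p1) mem_head.
case/mem_map_perm => -[[_ b1] c1] [u [/= <- s'u]].
rewrite (perm_big _ s'u) /=.
move: p1 p2 p3; rewrite !(permPr (perm_map _ s'u)) /= perm_cons => p1 p2 p3.
(* Its second component can be made equal to b. *)
have [v [-> {}p1 {}p2 {}p3]] : exists v,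
  [/\ \prod_(t <- (a, b1, c1) :: u) y t = \prod_(t <- (a, b, c1) :: v) y t,
     perm_eq [seq t.1.1 | t <- s] [seq t.1.1 | t <- v],
     perm_eq [seq t.1.2 | t <- s] [seq t.1.2 | t <- v]
   & perm_eq (c :: [seq t.2 | t <- s]) (c1 :: [seq t.2 | t <- v])].
  have : b \in b1 :: [seq t.1.2 | t <- u] by rewrite -(perm_mem p2) mem_head.
  rewrite inE => /predU1P[eb|].
    by exists u; split=> //; [rewrite eb | rewrite -(perm_cons b) {2}eb].
  case/mem_map_perm => -[[a2 _] c2] [w [/= <- uw]].
  exists ((a2, b1, c2) :: w); split.
  - by rewrite !big_cons (perm_big _ uw) big_cons !mulrA swap2.
  - by rewrite (permPl p1) (perm_map _ uw).
  - exact: perm_cons_exchange p2 (perm_map _ uw).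
  - by rewrite (permPl p3) perm_cons (perm_map _ uw).
(* So can its third component be made equal to c. *)
have : c \in c1 :: [seq t.2 | t <- v] by rewrite -(perm_mem p3) mem_head.
rewrite inE => /predU1P[ec|].
  by move: p3; rewrite -ec perm_cons !big_cons => p3; rewrite (IHs v).
case/mem_map_perm => -[[a2 b2] _] [w [/= <- vw]].
rewrite !big_cons (perm_big _ vw) big_cons mulrA swap3 -mulrA.
rewrite (IHs ((a2, b2, c1) :: w)) ?big_cons //=.
- by rewrite (permPl p1) (perm_map _ vw).
- by rewrite (permPl p2) (perm_map _ vw).
- exact: perm_cons_exchange p3 (perm_map _ vw).
Qed.

End Exchange.

(** * Kernels of monomial morphisms *)

Section Toric.
Variables (K : comNzRingType) (N M : nat) (A : 'I_N -> 'X_{1..M}).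

Lemma mpolyX_inj (k : nat) : injective (@mpolyX k K).
Proof.
move=> u v /(congr1 (mcoeff u)); rewrite !mcoeffX eqxx eq_sym.
by case: eqP => // _ /eqP; rewrite oner_eq0.
Qed.

(** The exponent of the image of the monomial of exponent [u] when the variable
    of index [i] is sent to the monomial of exponent [A i]. *)
Definition toric_exp (u : 'X_{1..N}) : 'X_{1..M} := (\sum_i A i *+ u i)%MM.

Definition toric_map : {mpoly K[N]} -> {mpoly K[M]} :=
  mmap (@mpolyC M K) (fun i => 'X_[A i]).

HB.instance Definition _ := GRing.RMorphism.on toric_map.

Lemma toric_mapX u : toric_map 'X_[u] = 'X_[toric_exp u].
Proof. by rewrite /toric_map mmapX /mmap1 mprodXnE. Qed.

Lemma toric_mapE f :
  toric_map f = \sum_(u <- msupp f) f@_u *: 'X_[toric_exp u].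
Proof.
rewrite {1}(mpolyE f) /toric_map raddf_sum; apply: eq_bigr => u _.
by rewrite /= mmapZ -/toric_map -toric_mapX mul_mpolyC.
Qed.

(** Choose a representative in every fibre of [toric_exp].  Replacing every
    monomial of [f] by the representative of its fibre does not change the
    class of [f] modulo [I], and it gives a polynomial whose coefficients are
    those of [toric_map f], hence zero. *)
Lemma toric_kernel (I : idealr {mpoly K[N]}) :
  (forall u v, toric_exp u = toric_exp v -> 'X_[u] - 'X_[v] \in I) ->
  forall f, toric_map f = 0 -> f \in I.
Proof.
move=> binI f f0.
pose rep d := xget 0%MM [set u | toric_exp u = d]%classic.
have repE u : toric_exp (rep (toric_exp u)) = toric_exp u.
  by apply: (@xgetPex _ _ [set v | toric_exp v = _]%classic); exists u.
suff : \sum_(u <- msupp f) f@_u *: 'X_[rep (toric_exp u)] = 0 :> {mpoly K[N]}.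
  move=> s0; rewrite -[f]subr0 -s0 {1}(mpolyE f) -sumrB rpred_sum // => u _.
  by rewrite -scalerBr -mul_mpolyC idealMr // binI.
(* Group the monomials of f by fibre. *)
pose D := undup [seq toric_exp u | u <- msupp f].
transitivity (\sum_(u <- msupp f) \sum_(d <- D)
    (f@_u * (toric_exp u == d)%:R) *: 'X_[rep d] : {mpoly K[N]}).
  rewrite !big_seq; apply: eq_bigr => u uf.
  rewrite (bigD1_seq (toric_exp u)) ?undup_uniq ?mem_undup ?map_f //=.
  rewrite eqxx mulr1 big1 ?addr0 // => d /negPf; rewrite eq_sym => ->.
  by rewrite mulr0 scale0r.
rewrite exchange_big big1 //= => d _; rewrite -scaler_suml.
have /(congr1 (mcoeff d)) := f0; rewrite toric_mapE raddf_sum mcoeff0 => fd0.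
rewrite (_ : \sum_(u <- _) _ = 0) ?scale0r // -[RHS]fd0.
by apply: eq_bigr => u _; rewrite /= mcoeffZ mcoeffX.
Qed.

Lemma toric_map_pihomog e d f : (0 < e)%N -> (forall i, mdeg (A i) = e) ->
  toric_map (pihomog mdeg d f) = pihomog mdeg (e * d) (toric_map f).
Proof.
move=> e_gt0 degA.
have deg_exp u : mdeg (toric_exp u) = (e * mdeg u)%N.
  rewrite /toric_exp mdeg_sum mdegE big_distrr; apply: eq_bigr => i _ /=.
  by rewrite mdegMn degA.
rewrite pihomogE /toric_map raddf_sum -/toric_map [in RHS]toric_mapE linear_sum.
rewrite big_mkcond; apply: eq_bigr => u _ /=.
rewrite linearZ /= pihomogX /= deg_exp eqn_pmul2l //.
by case: ifP => _; rewrite ?scaler0 // mmapZ -/toric_map -toric_mapX mul_mpolyC.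
Qed.

End Toric.

(** * Minors of size two *)

Section Minors2.
Variable R : comNzRingType.

Lemma det_mx2 (M : 'M[R]_2) :
  \det M = M ord0 ord0 * M ord_max ord_max - M ord0 ord_max * M ord_max ord0.
Proof.
rewrite (expand_det_row _ ord0) !big_ord_recl big_ord0 /cofactor !det_mx11 !mxE.
rewrite !mul1r addr0 mulN1r mulrN.
by congr (_ * M _ _ - M _ _ * M _ _); apply: val_inj.
Qed.

(** [minors] only selects increasing rows and columns; the other choices give
    zero or the opposite of such a minor. *)
Lemma swap_in_minors2 p q (M : 'M[R]_(p, q)) i i' j j' :
  M i j * M i' j' - M i' j * M i j' \in minors_ideal 2 M.
Proof.
wlog lt_i : i i' / (i < i')%N => [wl|].
  case: (ltngtP i i') => [||/val_inj->]; first exact: wl.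
    move=> /wl wlN; have := gen_idealMD (-1) wlN (gen_ideal0 _).
    by rewrite addr0 mulN1r opprB.
  by rewrite subrr gen_ideal0.
wlog lt_j : j j' / (j < j')%N => [wl|].
  case: (ltngtP j j') => [||/val_inj->]; first exact: wl.
    move=> /wl wlN; have := gen_idealMD (-1) wlN (gen_ideal0 _).
    by rewrite addr0 mulN1r opprB mulrC [X in _ - X]mulrC.
  by rewrite mulrC subrr gen_ideal0.
apply/asboolP; exists 1%N, (fun=> 1), (fun=> M i j * M i' j' - M i' j * M i j').
split; last by rewrite big_ord1 mul1r.
move=> _; exists (fun x => if x == ord0 then i else i').
exists (fun x => if x == ord0 then j else j').
split; last by rewrite det_mx2 !mxE /= [M i j' * _]mulrC.
  by move=> [[|[|x]] ?] [[|[|z]] ?].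
by move=> [[|[|x]] ?] [[|[|z]] ?].
Qed.

Lemma minors2_rank1 (S : comNzRingType) (g : {rmorphism R -> S}) p q
    (M : 'M[R]_(p, q)) (a : 'I_p -> S) (b : 'I_q -> S) :
  (forall i j, g (M i j) = a i * b j) ->
  {in minors_ideal 2 M, forall f, g f = 0}.
Proof.
move=> gM _ /asboolP[k [c [d [Md ->]]]].
rewrite raddf_sum big1 // => i _; rewrite /= rmorphM.
have [r [s [_ _ ->]]] := Md i.
rewrite det_mx2 !mxE rmorphB !rmorphM !gM.
by rewrite mulrACA [X in _ - X]mulrACA [b _ * b _]mulrC subrr mulr0.
Qed.

End Minors2.

(** * The Segre morphism and its kernel *)

Section Segre.
Variables (K : fieldType) (r m n : nat).
Local Notation T := ('I_r * 'I_m * 'I_n)%type.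
Local Notation U := ('I_r + 'I_m + 'I_n)%type.
Local Notation I := (ddet_ideal K r m n).

(** The exponent of [c_l a_i b_j]: the variables [c], [a], [b] of the target are
    indexed by the three summands of ['I_r + 'I_m + 'I_n]. *)
Definition segre_exp (t : T) : 'X_{1..#|{: U}|} :=
  (U_(enum_rank (inl (inl t.1.1) : U)) + U_(enum_rank (inl (inr t.1.2) : U))
   + U_(enum_rank (inr t.2 : U)))%MM.

Local Notation segre_exps := (fun i => segre_exp (enum_val i)).

Definition segre_map : tensor_ring K r m n -> {mpoly K[#|{: U}|]} :=
  @toric_map K _ _ segre_exps.
HB.instance Definition _ := GRing.RMorphism.on segre_map.

Lemma segre_map_var t :
  segre_map 'X_(enum_rank t) = 'X_[segre_exp t].
Proof. by rewrite /segre_map /toric_map mmapX mmap1U enum_rankK. Qed.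

Lemma segre_map_ddet f : f \in I -> segre_map f = 0.
Proof.
case/asboolP => u Hu [v Hv ->]; rewrite raddfD /=.
rewrite (@minors2_rank1 _ _ segre_map _ _ (hcat_mx K r m n)
  (fun i => 'X_(enum_rank (inl (inr i) : U)))
  (fun j => 'X_(enum_rank (inl (inl (tagnat.sig1 j)) : U))
          * 'X_(enum_rank (inr (tagnat.sig2 j) : U)))) //; last first.
  by move=> i j; rewrite !mxE /= segre_map_var !mpolyXD -mulrCA mulrA.
rewrite (@minors2_rank1 _ _ segre_map _ _ (vcat_mx K r m n)
  (fun i => 'X_(enum_rank (inl (inl (tagnat.sig1 i)) : U))
          * 'X_(enum_rank (inl (inr (tagnat.sig2 i)) : U)))
  (fun j => 'X_(enum_rank (inr j : U)))) ?addr0 //.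
by move=> i j; rewrite !mxE /= segre_map_var !mpolyXD.
Qed.

Lemma mnm_seqE (u : 'X_{1..#|{: T}|}) :
  exists s : seq T, u = (\sum_(t <- s) U_(enum_rank t))%MM.
Proof.
exists (flatten [seq nseq (u i) (enum_val i) | i <- enum 'I_#|{: T}|]).
rewrite big_flatten big_map big_enum /= {1}(multinomUE_id u).
apply: eq_bigr => i _; rewrite big_nseq enum_valK.
by elim: (u i) => // k IHk; rewrite mulmS IHk iterS.
Qed.

Lemma segre_exp_seq (s : seq T) :
  toric_exp segre_exps (\sum_(t <- s) U_(enum_rank t))%MM =
    (\sum_(t <- s) segre_exp t)%MM.
Proof.
apply: mpolyX_inj; rewrite -toric_mapX -[toric_map _ _]/(segre_map _).
rewrite -!mprodXE rmorph_prod; apply: eq_bigr => t _.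
exact: segre_map_var.
Qed.

(** The exponent of [c_l] in the image of a monomial counts the triples with
    first component [l], and similarly for [a_i] and [b_j]. *)
Lemma segre_exp_perm (s s' : seq T) :
  (\sum_(t <- s) segre_exp t = \sum_(t <- s') segre_exp t)%MM ->
  [/\ perm_eq [seq t.1.1 | t <- s] [seq t.1.1 | t <- s'],
      perm_eq [seq t.1.2 | t <- s] [seq t.1.2 | t <- s']
    & perm_eq [seq t.2 | t <- s] [seq t.2 | t <- s']].
Proof.
move=> ss'.
have perm_proj (Z : eqType) (h : T -> Z) (z : Z -> U) :
    (forall x t, segre_exp t (enum_rank (z x)) = (h t == x)) ->
  perm_eq [seq h t | t <- s] [seq h t | t <- s'].
  move=> hz; apply/allP => x _ /=; apply/eqP; rewrite !count_map.
  have /(congr1 (fun u : 'X_{1..#|{: U}|} => u (enum_rank (z x)))) := ss'.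
  rewrite !mnm_sumE !(eq_bigr _ (fun t _ => hz x t)) -!sum1_count.
  by move=> eq_ss'; rewrite big_mkcond [RHS]big_mkcond.
split.
- apply: (perm_proj _ _ (inl \o inl)) => x t.
  by rewrite !mnmDE !mnm1E !(inj_eq enum_rank_inj) !addn0.
- apply: (perm_proj _ _ (inl \o inr)) => x t.
  by rewrite !mnmDE !mnm1E !(inj_eq enum_rank_inj) !addn0.
- apply: (perm_proj _ _ inr) => x t.
  by rewrite !mnmDE !mnm1E !(inj_eq enum_rank_inj) !add0n.
Qed.

Lemma hcat_mxE l i j :
  hcat_mx K r m n i (tagnat.Rank l j) = 'X_(enum_rank (l, i, j)).
Proof.
have /matrixP/(_ i j) := mxrowK (@generic_mx K r m n) l.
by rewrite !mxE.
Qed.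

Lemma vcat_mxE l i j :
  vcat_mx K r m n (tagnat.Rank l i) j = 'X_(enum_rank (l, i, j)).
Proof.
have /matrixP/(_ i j) := mxcolK (@generic_mx K r m n) l.
by rewrite !mxE.
Qed.

Lemma hcat_minors_ddet : {subset minors_ideal 2 (hcat_mx K r m n) <= I}.
Proof.
move=> f Hf; apply/asboolP; exists f => //.
by exists 0; rewrite ?gen_ideal0 ?addr0.
Qed.

Lemma vcat_minors_ddet : {subset minors_ideal 2 (vcat_mx K r m n) <= I}.
Proof.
move=> f Vf; apply/asboolP; exists 0; first exact: gen_ideal0.
by exists f; rewrite ?add0r.
Qed.

(** In the quotient ring, the minors of H and V provide the two families
    of exchange relations required by [exchange_prod]. *)
Lemma segre_binomial u v :
  toric_exp segre_exps u = toric_exp segre_exps v ->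
  'X_[u] - 'X_[v] \in I.
Proof.
have [[s ->] [s' ->]] := (mnm_seqE u, mnm_seqE v).
rewrite !segre_exp_seq => /segre_exp_perm[p1 p2 p3].
rewrite Quotient.idealrBE -!mprodXE !rmorph_prod; apply/eqP.
apply: (@exchange_prod _ _ _ (coord_ring K r m n)
  (fun t => \pi_(coord_ring K r m n) 'X_(enum_rank t))) => //.
- move=> l i j l' i' j'; apply/eqP.
  rewrite -!rmorphM -Quotient.idealrBE -!hcat_mxE.
  exact/hcat_minors_ddet/swap_in_minors2.
- move=> l i j l' i' j'; apply/eqP.
  rewrite -!rmorphM -Quotient.idealrBE -!vcat_mxE [X in _ - X]mulrC.
  exact/vcat_minors_ddet/swap_in_minors2.
Qed.

Lemma ddet_idealP f : f \in I = (segre_map f == 0).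
Proof.
apply/idP/eqP => [/segre_map_ddet //|f0].
exact: (@toric_kernel _ _ _ _ I segre_binomial).
Qed.

Lemma ddet_ideal_prime : prime_ideal I.
Proof.
split; first exact: ddet_ideal_closed.
by move=> u v; rewrite !ddet_idealP rmorphM mulf_eq0.
Qed.

Lemma mdeg_segre_exp t : mdeg (segre_exp t) = 3.
Proof. by rewrite !mdegD !mdeg1. Qed.

Lemma ddet_ideal_homogeneous : homogeneous_ideal I.
Proof.
move=> f d; rewrite !ddet_idealP => /eqP f0; rewrite /segre_map.
rewrite (toric_map_pihomog (e := 3)) // => [|i]; last exact: mdeg_segre_exp.
by rewrite -/segre_map f0 raddf0.
Qed.

Lemma ddet_ideal_var t : 'X_(enum_rank t) \notin I.
Proof. by rewrite ddet_idealP segre_map_var -msize_poly_eq0 msizeX. Qed.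

End Segre.

(** * Domains and irreducible loci *)

Lemma coord_ring_domain (K : fieldType) (r m n : nat) :
  GRing.integral_domain_axiom (coord_ring K r m n).
Proof.
elim/quotW => x; elim/quotW => y; rewrite -rmorphM -(rmorph0 \pi) => /eqP.
have [_ prime_I] := ddet_ideal_prime K r m n.
rewrite -!Quotient.idealrBE !subr0; exact: prime_I.
Qed.

Lemma irreducible_generic (X : Type) (cl : set (set X)) (A : set X) (x : X) :
  A x -> (forall Z, cl Z -> Z x -> (A `<=` Z)%classic) ->
  irreducible_subset cl A.
Proof.
move=> Ax gen_x; split; first by exists x.
by move=> Z1 Z2 cl1 cl2 /(_ x Ax)[Zx|Zx]; [left | right]; apply: gen_x.
Qed.

Lemma irreducible_spec_locus (R : comNzRingType) (P : {pred R}) :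
  prime_ideal P -> irreducible_subset (@spec_closed R) (spec_locus [set` P]).
Proof.
move=> primeP; apply: (@irreducible_generic _ _ _ (Spec primeP)) => //.
by move=> _ [E _ <-] EP Q PQ f Ef; apply: PQ; apply: EP.
Qed.

Lemma irreducible_proj_locus (K : fieldType) (N : nat)
    (P : {pred {mpoly K[N]}}) (i : 'I_N) :
  prime_ideal P -> homogeneous_ideal P -> 'X_i \notin P ->
  irreducible_subset (@proj_closed K N) (proj_locus [set` P]).
Proof.
move=> primeP homP PXi.
have relP : ~ forall j, 'X_j \in P by move=> /(_ i); apply/negP.
apply: (@irreducible_generic _ _ _ (@Proj K N (Spec primeP) homP relP)) => //.
by move=> _ [E _ <-] EP Q PQ f Ef; apply: PQ; apply: EP.
Qed.

Theorem theorem3p1 (K : fieldType) (r m n : nat) :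
  perfect_field K -> (2 <= r)%N -> (2 <= m)%N -> (2 <= n)%N ->
  [/\ prime_ideal (ddet_ideal K r m n),
      GRing.integral_domain_axiom (coord_ring K r m n),
      irreducible_subset (@spec_closed _) (affine_ddet K r m n)
    & irreducible_subset (@proj_closed K _) (projective_ddet K r m n)].
Proof.
move=> _ r2 m2 n2; split.
- exact: ddet_ideal_prime.
- exact: coord_ring_domain.
- exact/irreducible_spec_locus/ddet_ideal_prime.
- (* Any variable witnesses that the ideal is not irrelevant. *)
  pose t := (Ordinal (ltnW r2), Ordinal (ltnW m2), Ordinal (ltnW n2)).
  apply: (@irreducible_proj_locus _ _ _ (enum_rank t)).
  + exact: ddet_ideal_prime.
  + exact: ddet_ideal_homogeneous.
  + exact: ddet_ideal_var.
Qed.
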